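(* Let $(R,M)$ be a local ring which is either an uncountable artinian ring or a noetherian ring with $|R|>2^{\aleph_0}$. If $I,J_1,J_2,\ldots$ are ideals of $R$ such that $I\subseteq \bigcup_{n=1}^\infty J_n$, then $I\subseteq J_n$ for some $n\geq 1$.
   Context: All rings are commutative with $1\neq 0$. $(R,M)$ local means that $M$ is the unique maximal ideal of $R$. *)

(* Defs.v *)
From mathcomp Require Import all_boot all_algebra.
From mathcomp Require Import all_classical.

Set Implicit Arguments.
Unset Strict Implicit.
Unset Printing Implicit Defensive.

Import GRing.Theory.
Local Open Scope ring_scope.
Local Open Scope classical_set_scope.
Local Open Scope card_scope.

(* [idealr_closed] from ring_quotient also requires [1 \notin I]; here the
   whole ring is an ideal. Closure under opposites is the case [a = -1]. *)
Definition is_ideal (R : comNzRingType) (I : set R) : Prop :=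
  [/\ I 0,
      forall x y, I x -> I y -> I (x + y)
    & forall a x, I x -> I (a * x)].

Definition is_maximal_ideal (R : comNzRingType) (M : set R) : Prop :=
  [/\ is_ideal M,
      M <> [set: R]
    & forall J : set R, is_ideal J -> M `<=` J -> J = M \/ J = [set: R]].

Definition is_local (R : comNzRingType) (M : set R) : Prop :=
  is_maximal_ideal M /\ forall N : set R, is_maximal_ideal N -> N = M.

Definition noetherian (R : comNzRingType) : Prop :=
  forall I : nat -> set R,
    (forall n, is_ideal (I n)) -> (forall n, I n `<=` I n.+1) ->
    exists N, forall n, (N <= n)%N -> I n = I N.

Definition artinian (R : comNzRingType) : Prop :=
  forall I : nat -> set R,
    (forall n, is_ideal (I n)) -> (forall n, I n.+1 `<=` I n) ->
    exists N, forall n, (N <= n)%N -> I n = I N.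

Definition card_lt (T U : Type) (A : set T) (B : set U) : Prop :=
  A #<= B /\ ~ (B #<= A).

(* Main.v *)
Require Import Defs.
From mathcomp Require Import all_boot all_algebra.
From mathcomp Require Import all_classical.
From mathcomp Require Import ring.

(** Write [k = R/M].  If [k] is uncountable, the pigeonhole principle shows that
    a finitely generated ideal inside a union of ideals [J n] is in one of them:
    given generators [x], [y] and others, each ideal generated by [x + c * y]
    and the others, for [c] in [R], lies (by induction on the number of
    generators) in some [J n]; two elements [c], [c'] in distinct classes mod
    [M] share the same [n], and as [c - c'] is a unit, [J n] contains [y] and
    then [x] ([sub_bigcup_adjoin_seq]).  So it remains to prove that every ideal
    is finitely generated and that [k] is uncountable.

    If [k] is countable and all powers of [M] are finitely generated, then each
    [M^n/M^(n+1)] is a quotient of some [k^r], so each [R/M^n] is countable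
    ([coset_cover_pow]).  When [R] is artinian, some [M^N] vanishes
    ([artinian_nilpotent]) and [R] is countable.  When [R] is noetherian, the
    powers of [M] meet in [0] by the intersection theorem of Krull ([krull]), so
    [R] embeds in the product of the [R/M^n] and has at most [2^aleph_0]
    elements.

    In an artinian ring, [I/MI] is finite-dimensional, since an infinite
    independent sequence would give the strictly decreasing chain of the spans
    of its tails ([artinian_fg_mod]); as [M] is nilpotent, generators of [I]
    modulo [MI] generate [I].

    Both the nilpotence of [M] and the theorem of Krull rest on infinite
    products of elements of [M] ([product_sequence]): if [M] is too far from
    being nilpotent modulo an ideal, there is a sequence [y n] with
    [y n.+1 = y n * x], [x] in [M], all of whose terms resist; a chain condition
    applied to the ideals generated by the [y n] (artinian case) or to their
    annihilators modulo an ideal (noetherian case) stops it. *)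

Local Open Scope ring_scope.
Local Open Scope classical_set_scope.
Local Open Scope card_scope.
Import GRing.Theory.

Set Implicit Arguments.
Unset Strict Implicit.
Unset Printing Implicit Defensive.

(** * Ideals and their generators *)

Section Ideals.
Variable R : comNzRingType.
Implicit Types (I J K L D M Q : set R) (x y z r : R) (s : seq R).

Lemma ideal0 I : is_ideal I -> I 0. Proof. by case. Qed.

Lemma idealD I x y : is_ideal I -> I x -> I y -> I (x + y).
Proof. by case=> _ + _; exact. Qed.

Lemma idealMl I r x : is_ideal I -> I x -> I (r * x).
Proof. by case=> _ _; exact. Qed.

Lemma idealMr I r x : is_ideal I -> I x -> I (x * r).
Proof. by rewrite mulrC; exact: idealMl. Qed.

Lemma idealN I x : is_ideal I -> I x -> I (- x).
Proof. by move=> iI Ix; rewrite -mulN1r; exact: idealMl. Qed.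

Lemma idealB I x y : is_ideal I -> I x -> I y -> I (x - y).
Proof. by move=> iI Ix Iy; apply: idealD => //; exact: idealN. Qed.

Lemma ideal_set0 : is_ideal [set (0 : R)].
Proof.
split=> //= [x y -> ->|a x ->]; first by rewrite addr0.
by rewrite mulr0.
Qed.

Lemma ideal_setT : is_ideal [set: R]. Proof. by []. Qed.

Lemma ideal_bigcap T (P : set T) (F : T -> set R) :
  (forall i, P i -> is_ideal (F i)) -> is_ideal (\bigcap_(i in P) F i).
Proof.
move=> iF; split=> [i /iF/ideal0 //|x y Fx Fy i Pi|a x Fx i Pi].
- by apply: idealD; [exact: iF | exact: Fx | exact: Fy].
- by apply: idealMl; [exact: iF | exact: Fx].
Qed.

Lemma ideal_bigcup_nat (F : nat -> set R) :
  (forall n, is_ideal (F n)) -> (forall n, F n `<=` F n.+1) ->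
  is_ideal (\bigcup_n F n).
Proof.
move=> iF incF.
have leF m n : (m <= n)%N -> F m `<=` F n.
  elim: n => [|n IHn]; first by rewrite leqn0 => /eqP->.
  rewrite leq_eqVlt => /predU1P[->//|/IHn mn].
  exact: subset_trans mn (incF n).
split=> [|x y [m _ Fx] [n _ Fy]|a x [n _ Fx]].
- by exists 0%N => //; exact: ideal0.
- exists (maxn m n) => //; apply: idealD => //.
    exact: (leF m) (leq_maxl _ _) _ Fx.
  exact: (leF n) (leq_maxr _ _) _ Fy.
- by exists n => //; exact: idealMl.
Qed.

Definition colon K z : set R := [set y | K (z * y)].

Lemma ideal_colon K z : is_ideal K -> is_ideal (colon K z).
Proof.
move=> iK; split; rewrite /colon /= ?mulr0; first exact: ideal0.
- by move=> x y Kx Ky; rewrite mulrDr; exact: idealD.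
- by move=> a x Kx; rewrite mulrCA; exact: idealMl.
Qed.

Definition adjoin L x : set R := [set z | exists r, L (z - r * x)].

Lemma ideal_adjoin L x : is_ideal L -> is_ideal (adjoin L x).
Proof.
move=> iL; split=> [|y z [r Ly] [r' Lz]|a y [r Ly]].
- by exists 0; rewrite mul0r subr0; exact: ideal0.
- by exists (r + r'); rewrite mulrDl opprD addrACA; exact: idealD.
- by exists (a * r); rewrite -mulrA -mulrBr; exact: idealMl.
Qed.

Lemma sub_adjoin L x : L `<=` adjoin L x.
Proof. by move=> y Ly; exists 0; rewrite mul0r subr0. Qed.

Lemma mem_adjoin L x : is_ideal L -> adjoin L x x.
Proof. by move=> iL; exists 1; rewrite mul1r subrr; exact: ideal0. Qed.

Lemma adjoin_sub L x K :
  is_ideal K -> L `<=` K -> K x -> adjoin L x `<=` K.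
Proof.
move=> iK LK Kx y [r Ly]; rewrite -(subrK (r * x) y).
by apply: idealD => //; [exact: LK | exact: idealMl].
Qed.

Definition adjoin_seq L s : set R := foldr (fun x K => adjoin K x) L s.

Lemma ideal_adjoin_seq L s : is_ideal L -> is_ideal (adjoin_seq L s).
Proof. by move=> iL; elim: s => //= x s IHs; exact: ideal_adjoin. Qed.

Lemma mem_adjoin_seq L s x : is_ideal L -> x \in s -> adjoin_seq L s x.
Proof.
move=> iL; elim: s => //= y s IHs; rewrite inE => /predU1P[->|/IHs].
  by apply: mem_adjoin; exact: ideal_adjoin_seq.
exact: sub_adjoin.
Qed.

Lemma adjoin_seq_sub L s K :
  is_ideal K -> L `<=` K -> [set` s] `<=` K -> adjoin_seq L s `<=` K.
Proof.
move=> iK LK; elim: s => //= x s IHs sK; apply: adjoin_sub => //.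
  by apply: IHs => y sy; apply: sK; rewrite /= inE sy orbT.
by apply: sK; rewrite /= inE eqxx.
Qed.

Definition fg I := exists s, I = adjoin_seq [set 0] s.

Lemma fg_ideal I : fg I -> is_ideal I.
Proof. by case=> s ->; exact: ideal_adjoin_seq ideal_set0. Qed.

Definition idmul I J : set R :=
  smallest (@is_ideal R) [set x * y | x in I & y in J].

Lemma ideal_idmul I J : is_ideal (idmul I J).
Proof. by apply: ideal_bigcap => K []. Qed.

Lemma mem_idmul I J x y : I x -> J y -> idmul I J (x * y).
Proof. by move=> Ix Jy; apply: sub_gen_smallest; exists x => //; exists y. Qed.

Lemma idmul_sub I J K : is_ideal K ->
  (forall x y, I x -> J y -> K (x * y)) -> idmul I J `<=` K.
Proof.
by move=> iK IJK; apply: smallest_sub => // _ [x Ix [y Jy <-]]; exact: IJK.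
Qed.

Lemma idmul_subr I J : is_ideal J -> idmul I J `<=` J.
Proof. by move=> iJ; apply: idmul_sub => // x y _; exact: idealMl. Qed.

Definition idpow M n : set R := iter n (idmul M) [set: R].

Lemma ideal_idpow M n : is_ideal (idpow M n).
Proof. by case: n => [|n]; [exact: ideal_setT | exact: ideal_idmul]. Qed.

Lemma idpowS_sub M n : idpow M n.+1 `<=` idpow M n.
Proof. by apply: idmul_subr; exact: ideal_idpow. Qed.

Lemma idpow_le M m n : (m <= n)%N -> idpow M n `<=` idpow M m.
Proof.
elim: n => [|n IHn]; first by rewrite leqn0 => /eqP->.
rewrite leq_eqVlt => /predU1P[->//|/IHn mn].
exact: subset_trans (@idpowS_sub M n) mn.
Qed.

(** * Local rings *)

Section Local.
Variable M : set R.
Hypothesis hM : is_local M.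

Lemma local_ideal : is_ideal M. Proof. by case: hM => [[]]. Qed.

(** Otherwise [a] generates a proper ideal, and an ideal maximal among the
    proper ones containing [a], which exists by Zorn, differs from [M]. *)
Lemma local_unit a : ~ M a -> exists b, b * a = 1.
Proof.
move=> Ma; apply: contrapT => unitN.
(* The empty set is let in because it is the union of the empty chain. *)
pose P A := A = set0 \/ [/\ is_ideal A, A a & ~ A 1].
have Pa : P (adjoin [set 0] a).
  right; split.
  - exact: ideal_adjoin ideal_set0.
  - exact: mem_adjoin ideal_set0.
  - by move=> [r] /= /eqP; rewrite subr_eq0 => /eqP ra; apply: unitN; exists r.
have [F FP Ftot|A [PA maxA]] := @Zorn_bigcup _ P.
  have [[A [FA A0]]|FN] := pselect (exists A, F A /\ A !=set0); last first.
    left; rewrite -subset0 => x [A FA Ax]; apply: FN; exists A; split=> //.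
    by exists x.
  have FI B x : F B -> B x -> [/\ is_ideal B, B a & ~ B 1].
    by move=> /FP[-> //|].
  have [x0 Ax0] := A0; have [iA Aa A1] := FI _ _ FA Ax0.
  right; split; last 2 first.
  - by exists A.
  - by move=> [B FB B1]; have [_ _] := FI _ _ FB B1; exact.
  split=> [|x y [B FB Bx] [C FC Cy]|r x [B FB Bx]].
  - by exists A => //; exact: ideal0.
  - have [iB _ _] := FI _ _ FB Bx; have [iC _ _] := FI _ _ FC Cy.
    have [BC|CB] := Ftot _ _ FB FC.
      by exists C => //; apply: idealD => //; exact: BC.
    by exists B => //; apply: idealD => //; exact: CB.
  - by have [iB _ _] := FI _ _ FB Bx; exists B => //; exact: idealMl.
case: PA => [A0|[iA Aa A1]].
  apply: (maxA (adjoin [set 0] a)) => //; rewrite A0; split=> // /(_ a).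
  by apply; exact: mem_adjoin ideal_set0.
suff Amax : is_maximal_ideal A by apply: Ma; rewrite -(hM.2 _ Amax).
split=> // [AT|J iJ AJ]; first by apply: A1; rewrite AT.
have [J1|J1] := pselect (J 1).
  by right; apply/seteqP; split=> // x _; rewrite -[x]mulr1; exact: idealMl.
left; apply/seteqP; split=> //; apply: contrapT => JA.
by apply: (maxA J); [split | right; split=> //; exact: AJ].
Qed.

Lemma local_unit1B m : M m -> exists b, b * (1 - m) = 1.
Proof.
move=> Mm; apply: local_unit => M1m; case: hM => -[_ + _] _; apply.
apply/seteqP; split=> // x _; rewrite -[x]mulr1; apply: idealMl => //.
  exact: local_ideal.
by rewrite -(subrK m 1); apply: idealD => //; exact: local_ideal.
Qed.

Lemma local_fix0 m L x : M m -> is_ideal L -> L (x - m * x) -> L x.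
Proof.
move=> Mm iL; have [b b1] := local_unit1B Mm.
rewrite -{1}(mul1r x) -mulrBl => /(idealMl b iL).
by rewrite mulrA b1 mul1r.
Qed.

(** Nakayama: modulo the other generators, the first generator [x] satisfies
    [x = m * x] with [m] in [M], so it is redundant; drop the generators one by
    one. *)
Lemma nakayama D : fg D -> D `<=` idmul M D -> D `<=` [set 0].
Proof.
case=> s; elim: s D => [|x s IHs] D /=; first by move=> -> _ x.
set D' := adjoin_seq _ s => DE.
have iD' : is_ideal D' by exact: ideal_adjoin_seq ideal_set0.
have iM := local_ideal.
move=> DMD; suff D'x : D' x.
  suff DD' : D = D' by apply: IHs.
  rewrite DE; apply/seteqP; split; last exact: sub_adjoin.
  exact: adjoin_sub.
pose K := [set z | exists2 m, M m & D' (z - m * x)].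
have iK : is_ideal K.
  split=> [|y z [m Mm Dy] [m' Mm' Dz]|a y [m Mm Dy]].
  - by exists 0; [exact: ideal0 | rewrite mul0r subr0; exact: ideal0].
  - exists (m + m'); first exact: idealD.
    by rewrite mulrDl opprD addrACA; exact: idealD.
  - exists (a * m); first exact: idealMl.
    by rewrite -mulrA -mulrBr; exact: idealMl.
have : K x.
  apply: (@idmul_sub M D K iK) => [m y Mm|]; last first.
    by apply: DMD; rewrite DE; exact: mem_adjoin.
  rewrite DE => -[r D'y]; exists (m * r); first exact: idealMr.
  by rewrite -mulrA -mulrBr; exact: idealMl.
by case=> m Mm; exact: local_fix0.
Qed.

(** * Chain conditions *)

Lemma product_sequence (good : R -> Prop) : good 1 ->
  (forall y, good y -> exists2 x, M x & good (y * x)) ->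
  exists y : nat -> R,
    forall n, good (y n) /\ exists2 x, M x & y n.+1 = y n * x.
Proof.
move=> good1 goodM.
have [y|f fP] := @choice _ _ (fun y x => good y -> M x /\ good (y * x)).
  have [gy|gy] := pselect (good y); last by exists 0.
  by have [x] := goodM y gy; exists x.
pose y n := iter n (fun z => z * f z) 1.
have gy n : good (y n) by elim: n => //= n /fP[].
by exists y => n; split=> //; exists (f (y n)) => //; case: (fP _ (gy n)).
Qed.

(** The powers of [M] stabilise at some [A] with [A = M A].  If [y] does not
    kill [A], neither does [y * x] for some [x] in [M]; this yields a sequence
    of products whose generated ideals decrease strictly. *)
Lemma artinian_nilpotent :
  artinian R -> exists N, idpow M N `<=` [set 0].
Proof.
move=> art; have [n|n|N stN] := art (idpow M).
- exact: ideal_idpow.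
- exact: idpowS_sub.
exists N; apply: contrapT => MN0.
have [a Aa a0] : exists2 a, idpow M N a & a <> 0.
  apply: contrapT => aN; apply: MN0 => a Aa; apply: contrapT => a0.
  by apply: aN; exists a.
pose good y := exists2 b, idpow M N b & y * b <> 0.
have [| y [b Ab yb]|y yP] := @product_sequence good.
- by exists a => //; rewrite mul1r.
- apply: contrapT => yN; apply: yb.
  suff : colon [set 0] y b by [].
  move: Ab; rewrite -(stN N.+1) //; apply: idmul_sub.
    exact: ideal_colon ideal_set0.
  move=> x c Mx Ac; rewrite /colon /= mulrA; apply: contrapT => yxc.
  by apply: yN; exists x => //; exists c.
have iy n : is_ideal (adjoin [set 0] (y n)) by exact: ideal_adjoin ideal_set0.
have [n|n|m stm] := art (fun n => adjoin [set 0] (y n)).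
- exact: iy.
- have [_ [x Mx ->]] := yP n; apply: adjoin_sub => //; first exact: sub_adjoin.
  by apply: idealMr => //; exact: mem_adjoin ideal_set0.
have [[b _ yb] [x Mx yS]] := yP m; apply: yb.
suff -> : y m = 0 by rewrite mul0r.
have : adjoin [set 0] (y m) (y m) by exact: mem_adjoin ideal_set0.
rewrite -(stm m.+1) // yS => -[r].
rewrite (mulrC (y m)) mulrA; apply: local_fix0 => //; last exact: ideal_set0.
exact: idealMl local_ideal _.
Qed.

(** Otherwise there are [x n] in [I] such that no [x n] lies in the span [V n]
    of [M I] and the [x j], [j < n].  The spans [K n] of [M I] and the [x j],
    [n <= j], stabilise, so some [x n] is a combination of later ones modulo
    [M I]; its last term with a unit coefficient contradicts independence, and
    if there is none then [x n] is in [M I]. *)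
Lemma artinian_fg_mod I : artinian R -> is_ideal I ->
  exists2 s, [set` s] `<=` I & I `<=` adjoin_seq (idmul M I) s.
Proof.
move=> art iI; apply: contrapT => nfg.
have iMI := ideal_idmul M I.
have [V|f fP] := @choice _ _
    (fun V x => ~ (I `<=` V) -> I x /\ ~ V x).
  have [IV|IV] := pselect (I `<=` V); first by exists 0.
  suff [x [Ix Vx]] : exists x, I x /\ ~ V x by exists x.
  apply: contrapT => xN; apply: IV => x Ix; apply: contrapT => Vx.
  by apply: xN; exists x.
pose V n := iter n (fun V => adjoin V (f V)) (idmul M I).
pose x n := f (V n).
have xP n : I (x n) /\ ~ V n (x n).
  suff [s sI Vs] : exists2 s, [set` s] `<=` I & V n = adjoin_seq (idmul M I) s.
    by apply: fP => IV; apply: nfg; exists s => //; rewrite -Vs.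
  elim: n => [|n [s sI Vs]]; first by exists [::].
  exists (f (V n) :: s); last by rewrite /= -Vs.
  have [If _] : I (f (V n)) /\ ~ V n (f (V n)).
    by apply: fP => IV; apply: nfg; exists s => //; rewrite -Vs.
  by move=> y /=; rewrite inE => /predU1P[->//|/sI].
have iV n : is_ideal (V n) by elim: n => //= n; exact: ideal_adjoin.
have VS n : V n `<=` V n.+1 by exact: sub_adjoin.
have Vx n : V n.+1 (x n) := mem_adjoin (x n) (iV n).
have VMI n : idmul M I `<=` V n.
  by elim: n => // n IHn; exact: subset_trans IHn (VS n).
pose K n := smallest (@is_ideal R)
  (idmul M I `|` [set x j | j in [set j | (n <= j)%N]]).
have iK n : is_ideal (K n) by apply: ideal_bigcap => L [].
have [n|n|n stn] := art K; first exact: iK.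
  apply: smallest_sub => // z zP; apply: sub_gen_smallest.
  case: zP => [|[j nj <-]]; [by left | right; exists j => //].
  exact: ltnW nj.
(* The part of [K n.+1] spanned by [M I] and the first [k] terms of the tail. *)
pose W k := iteri k (fun j L => adjoin L (x (n.+1 + j)%N)) (idmul M I).
have iW k : is_ideal (W k) by elim: k => //= k; exact: ideal_adjoin.
have WMI k : idmul M I `<=` W k.
  by elim: k => // k IHk; apply: subset_trans IHk _; exact: sub_adjoin.
have WV k : W k `<=` V (n.+1 + k)%N.
  elim: k => [|k IHk]; first exact: VMI.
  rewrite addnS; apply: adjoin_sub; first exact: iV.
    exact: subset_trans IHk (VS _).
  exact: Vx.
have xW k : ~ W k (x n).
  elim: k => [/(VMI n)|k IHk]; first exact: (xP n).2.
  rewrite /W /= -/(W k); case=> r Wr; have [Mr|Mr] := pselect (M r).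
    apply: IHk; rewrite -(subrK (r * x (n.+1 + k)%N) (x n)).
    apply: idealD => //; apply: WMI; apply: mem_idmul => //.
    by case: (xP (n.+1 + k)%N).
  have [b b1] := local_unit Mr.
  have [_] := xP (n.+1 + k)%N; apply; set z := x (n.+1 + k)%N in Wr *.
  have Vz : V (n.+1 + k)%N (r * z).
    rewrite -[r * z](subKr (x n)); apply: idealB => //; last exact: WV.
    elim: (k) => [|j IHj]; first by rewrite addn0; exact: Vx.
    by rewrite addnS; exact: VS.
  by rewrite -[z]mul1r -b1 -mulrA; exact: idealMl.
have : K n (x n) by apply: sub_gen_smallest; right; exists n => //=.
rewrite -(stn n.+1) // => Kx.
suff [k _] : (\bigcup_k W k) (x n) by exact: xW.
move: (x n) Kx; apply: smallest_sub.
  by apply: ideal_bigcup_nat => // k; exact: sub_adjoin.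
move=> z [MIz|[j nj <-]]; first by exists 0%N.
exists (j - n.+1).+1 => //; rewrite /W /= subnKC //.
by apply: mem_adjoin; exact: iW.
Qed.

(** Lift generators of [I/MI] to [I]: with [K] the ideal they generate, if
    [M^(n+1) I] is contained in [K] then so is
    [M^n I = M^n (K + M I)]; descend from [M^N = 0] to [M^0 = R]. *)
Lemma artinian_fg I : artinian R -> is_ideal I -> fg I.
Proof.
move=> art iI; have [N MN0] := artinian_nilpotent art.
have [s sI Is] := artinian_fg_mod art iI.
exists s; set K := adjoin_seq _ s.
have iK : is_ideal K by exact: ideal_adjoin_seq ideal_set0.
have MK n z x : (n <= N)%N -> idpow M (N - n) z -> I x -> K (z * x).
  elim: n z x => [|n IHn] z x nN.
    by rewrite subn0 => /MN0-> _; rewrite mul0r; exact: ideal0.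
  move=> Mz /Is; suff : adjoin_seq (idmul M I) s `<=` colon K z by exact.
  have iKz := ideal_colon z iK.
  apply: adjoin_seq_sub => // [|y sy]; last first.
    by apply: idealMl => //; exact: mem_adjoin_seq ideal_set0 sy.
  apply: idmul_sub => // m y Mm Iy; rewrite /colon /= mulrA.
  apply: IHn => //; first exact: ltnW.
  by rewrite -subSS subSn // mulrC; exact: mem_idmul.
apply/seteqP; split=> [x Ix|].
  by rewrite -[x]mul1r; apply: (MK N) => //; rewrite subnn.
by apply: adjoin_seq_sub => // _ ->; exact: ideal0.
Qed.

Lemma noetherian_max (P : set R -> Prop) K0 : noetherian R ->
  (forall K, P K -> is_ideal K) -> P K0 ->
  exists2 K, P K & forall L, P L -> K `<=` L -> L `<=` K.
Proof.
move=> noe iP PK0; apply: contrapT => maxN.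
have [K|f fP] := @choice _ _
    (fun K L => P K -> [/\ P L, K `<=` L & ~ (L `<=` K)]).
  have [PK|PK] := pselect (P K); last by exists K.
  apply: contrapT => LN; apply: maxN; exists K => // L PL KL.
  by apply: contrapT => LK; apply: LN; exists L.
pose K n := iter n f K0.
have PK n : P (K n) by elim: n => //= n /fP[].
have [n|n|n st] := noe K; first exact: iP.
  by case: (fP _ (PK n)).
by case: (fP _ (PK n)) => _ _; apply; rewrite -[f _]/(K n.+1) (st n.+1).
Qed.

Lemma noetherian_fg I : noetherian R -> is_ideal I -> fg I.
Proof.
move=> noe iI.
have [K [_ /fg_ideal//]||K [KI [s sK]] maxK] :=
  @noetherian_max (fun K => K `<=` I /\ fg K) [set 0] noe.
  by split; [move=> _ ->; exact: ideal0 | exists [::]].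
have iK : is_ideal K by apply: fg_ideal; exists s.
suff -> : I = K by exists s.
apply/seteqP; split=> // x Ix; apply: (maxK (adjoin K x)).
- by split; [exact: adjoin_sub | exists (x :: s); rewrite sK].
- exact: sub_adjoin.
- exact: mem_adjoin.
Qed.

(** Let [D] be the intersection of the powers of [M], and [K] an ideal maximal
    among those meeting [D] in [M D].  Were no [M^N] contained in [K], there
    would be products [y n] of elements of [M] with [M^m * y n] never contained
    in [K].  But [colon K (y n) = colon K (y n.+1)] for some [n], which makes
    [K + R * y n] meet [D] in [M D]: if [d = k + r * y n] and [y n.+1 = y n * x]
    then [x * d] is in [M D], so [r * y n.+1] and hence [r * y n] are in [K].
    By maximality [y n] is in [K], a contradiction.  So [D], contained in [K],
    is [M D], and [D = 0] by Nakayama. *)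
Lemma krull : noetherian R -> \bigcap_n idpow M n `<=` [set 0].
Proof.
move=> noe; set D := \bigcap_n _.
have iD : is_ideal D by apply: ideal_bigcap => n _; exact: ideal_idpow.
apply: nakayama; first exact: noetherian_fg.
pose P K := [/\ is_ideal K, idmul M D `<=` K & K `&` D `<=` idmul M D].
have [K []//||K [iK MDK KD] maxK] := @noetherian_max P (idmul M D) noe.
  by split=> [|//|x []//]; exact: ideal_idmul.
suff [N MNK] : exists N, idpow M N `<=` K.
  by move=> x Dx; apply: KD; split=> //; apply: MNK; exact: Dx.
apply: contrapT => MK.
pose good y := forall m, ~ (idpow M m `<=` colon K y).
have [m MmK|y goody|y yP] := @product_sequence good.
- by apply: MK; exists m => z /MmK; rewrite /colon /= mul1r.
- apply: contrapT => yN.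
  have yM x : M x -> exists m, idpow M m `<=` colon K (y * x).
    by move=> Mx; apply: contrapT => xN; apply: yN; exists x => // m ?;
       apply: xN; exists m.
  have [s sM] := noetherian_fg noe local_ideal.
  have [m ms] : exists m, forall x, x \in s -> idpow M m `<=` colon K (y * x).
    have : [set` s] `<=` M.
      by move=> x sx; rewrite sM; exact: mem_adjoin_seq ideal_set0 sx.
    elim: (s) => [|x t IHt] tM; first by exists 0%N.
    have [|m mt] := IHt.
      by move=> z tz; apply: tM; rewrite /= inE tz orbT.
    have [|n nx] := yM x; first by apply: tM; rewrite /= inE eqxx.
    exists (maxn m n) => z; rewrite inE => /predU1P[->|/mt zm].
      exact: subset_trans (idpow_le (leq_maxr _ _)) nx.
    exact: subset_trans (idpow_le (leq_maxl _ _)) zm.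
  apply: (goody m.+1); apply: idmul_sub => [|x b Mx Mb].
    exact: ideal_colon.
  rewrite /colon /= mulrCA mulrC -/(colon K (y * b) x).
  move: x Mx; rewrite sM; apply: adjoin_seq_sub.
  + exact: ideal_colon.
  + by move=> _ ->; exact: (ideal0 (ideal_colon _ iK)).
  + by move=> x /ms /(_ b Mb); rewrite /colon /= mulrAC.
have [n|n z|n st] := noe (fun n => colon K (y n)).
- exact: ideal_colon.
- have [_ [x _ ->]] := yP n.
  by rewrite /colon /= => Kz; rewrite mulrAC; exact: idealMr.
have [goody [x Mx yS]] := yP n.
suff Ky : K (y n) by apply: (goody 0%N) => z _; exact: idealMr.
apply: (maxK (adjoin K (y n))); [|exact: sub_adjoin|exact: mem_adjoin].
split; first exact: ideal_adjoin.
  by apply: subset_trans MDK _; exact: sub_adjoin.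
move=> d [[r Kr] Dd]; apply: KD; split=> //.
rewrite -(subrK (r * y n) d); apply: idealD => //.
suff : colon K (y n) r by rewrite /colon /= mulrC.
rewrite -(st n.+1) // /colon /= yS.
have -> : y n * x * r = x * d - x * (d - r * y n).
  by rewrite -mulrBr subKr [r * _]mulrC mulrA (mulrC x).
apply: idealB => //; last exact: idealMl.
by apply: MDK; exact: mem_idmul.
Qed.

(** * Countability of the quotients by the powers of the maximal ideal *)

(** For ideals this says that the image of [A] in [R/B] is countable; with
    explicit representatives, covers compose without forming quotients. *)
Definition coset_cover (A B : set R) :=
  exists t : nat -> R, forall x, A x -> exists n, B (x - t n).

Lemma coset_cover_trans (A B C : set R) :
  coset_cover A B -> coset_cover B C -> coset_cover A C.
Proof.
move=> [t tP] [u uP].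
exists (fun n => if unpickle n is Some (i, j) then t i + u j else 0) => x.
move=> /tP[i /uP[j Cj]]; exists (pickle (i, j)).
by rewrite pickleK opprD addrA.
Qed.

Lemma coset_cover_adjoin L Q x : is_ideal Q -> coset_cover setT M ->
  (forall m, M m -> Q (m * x)) -> coset_cover L Q -> coset_cover (adjoin L x) Q.
Proof.
move=> iQ [t tP] MxQ [u uP].
exists (fun n => if unpickle n is Some (i, j) then t i * x + u j else 0) => y.
move=> [r /uP[j Qj]]; have [i Mi] := tP r I; exists (pickle (i, j)).
rewrite pickleK.
have -> : y - (t i * x + u j) = (y - r * x - u j) + (r - t i) * x by ring.
by apply: idealD => //; exact: MxQ.
Qed.

Lemma coset_cover_pow : (forall I, is_ideal I -> fg I) ->
  coset_cover setT M -> forall n, coset_cover setT (idpow M n).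
Proof.
move=> allfg cM; elim=> [|n IHn]; first by exists (fun=> 0) => x; exists 0%N.
apply: coset_cover_trans IHn _.
have [s Ms] := allfg _ (ideal_idpow M n); have iM' := ideal_idpow M n.+1.
have : [set` s] `<=` idpow M n.
  by move=> x sx; rewrite Ms; exact: mem_adjoin_seq ideal_set0 sx.
rewrite [X in coset_cover X _]Ms; elim: {Ms} s => [|x s IHs] sM /=.
  by exists (fun=> 0) => x ->; exists 0%N; rewrite subr0; exact: ideal0.
apply: coset_cover_adjoin => //.
  by move=> m Mm; apply: mem_idmul => //; apply: sM; rewrite /= inE eqxx.
by apply: IHs => y sy; apply: sM; rewrite /= inE sy orbT.
Qed.

Lemma coset_cover0_countable : coset_cover setT [set 0] -> countable [set: R].
Proof.
move=> [t tP]; have [f fP] := choice (fun x => tP x I).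
have tf x : t (f x) = x.
  by apply/eqP; rewrite eq_sym -subr_eq0; apply/eqP; exact: fP.
rewrite /countable -(card_le_eql (@inj_card_eq _ _ setT f _)).
  exact: subset_card_le.
by move=> x y _ _ fxy; rewrite -(tf x) fxy tf.
Qed.

(** A family of countable covers by cosets of the [F n] codes each element by a
    sequence of natural numbers. *)
Lemma coset_cover_card (F : nat -> set R) :
  (forall n, is_ideal (F n)) -> (forall n, coset_cover setT (F n)) ->
  \bigcap_n F n `<=` [set 0] -> [set: R] #<= [set: set nat].
Proof.
move=> iF /choice[t tP] F0.
have /choice[f fP] x : exists g : nat -> nat, forall n, F n (x - t n (g n)).
  by have [g gP] := choice (fun n => tP n x I); exists g.
pose h x := [set pickle (n, f x n) | n in [set: nat]].
rewrite -(card_le_eql (@inj_card_eq _ _ setT h _)); first exact: subset_card_le.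
move=> x y _ _ hxy; apply/eqP; rewrite -subr_eq0; apply/eqP.
apply: F0 => n _.
have : h x (pickle (n, f x n)) by exists n.
rewrite hxy => -[m _ /(pcan_inj pickleK)[-> fxy]].
have -> : x - y = (x - t n (f x n)) - (y - t n (f x n)) by ring.
by apply: idealB => //; rewrite -fxy.
Qed.

(** * Countable unions of ideals *)

Lemma coset_pigeonhole (phi : R -> nat) : ~ coset_cover setT M ->
  exists c c', phi c = phi c' /\ ~ M (c - c').
Proof.
move=> ncM; apply: contrapT => phiN; apply: ncM.
have [n|t tP] := @choice _ _ (fun n t => forall c, phi c = n -> phi t = n).
  have [[c cn]|cN] := pselect (exists c, phi c = n); first by exists c.
  by exists 0 => c cn; case: cN; exists c.
exists t => c _; exists (phi c); apply: contrapT => Mc.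
by apply: phiN; exists c, (t (phi c)); rewrite (tP _ c).
Qed.

(** For each [c], the ideal generated by [x + c * y] and [s] lies in some
    [J n] by induction; two values of [c] in distinct classes mod [M] give the
    same [n], and then [y] and [x] are in [J n]. *)
Lemma sub_bigcup_adjoin_seq (J : nat -> set R) s : ~ coset_cover setT M ->
  (forall n, is_ideal (J n)) -> adjoin_seq [set 0] s `<=` \bigcup_n J n ->
  exists n, adjoin_seq [set 0] s `<=` J n.
Proof.
move=> ncM iJ; have i0 := ideal_set0.
have J0 n : [set 0] `<=` J n by move=> _ ->; exact: ideal0.
case: s => [|x s]; first by exists 0%N.
elim: s x => [|y s IHs] x sJ.
  have [|n _ Jx] := sJ x; first exact: mem_adjoin.
  by exists n; apply: adjoin_sub.
set A := adjoin_seq _ _ in sJ *.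
have iA : is_ideal A by exact: ideal_adjoin_seq.
have mA z : z \in [:: x, y & s] -> A z by exact: mem_adjoin_seq.
have /choice[phi phiP] c :
    exists n, adjoin_seq [set 0] (x + c * y :: s) `<=` J n.
  apply: IHs; apply: subset_trans sJ; apply: adjoin_seq_sub => //.
    by move=> _ ->; exact: ideal0.
  move=> z /=; rewrite inE => /predU1P[->|sz].
    apply: idealD => //; first by apply: mA; rewrite inE eqxx.
    by apply: idealMl => //; apply: mA; rewrite !inE eqxx orbT.
  by apply: mA; rewrite !inE sz !orbT.
have [c [c' [cc' /local_unit[b b1]]]] := coset_pigeonhole phi ncM.
have Jc : J (phi c) (x + c * y).
  by apply: phiP; apply: mem_adjoin_seq => //; rewrite inE eqxx.
have Jc' : J (phi c) (x + c' * y).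
  by rewrite cc'; apply: phiP; apply: mem_adjoin_seq => //; rewrite inE eqxx.
have Jy : J (phi c) y.
  have -> : y = b * ((x + c * y) - (x + c' * y)).
    by rewrite -[LHS]mul1r -b1; ring.
  by apply: idealMl => //; exact: idealB.
exists (phi c); apply: adjoin_seq_sub => // z /=.
rewrite !inE => /or3P[/eqP->|/eqP->//|sz].
  by rewrite -(addrK (c * y) x); apply: idealB => //; exact: idealMl.
by apply: (phiP c); apply: mem_adjoin_seq => //; rewrite inE sz orbT.
Qed.

End Local.
End Ideals.

Theorem corollary2p22 (R : comNzRingType) (M : set R)
    (hlocal : is_local M)
    (hR : (~ countable [set: R] /\ artinian R) \/
          (noetherian R /\ card_lt [set: set nat] [set: R]))
    (I : set R) (J : nat -> set R)
    (hI : is_ideal I)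
    (hJ : forall n : nat, (1 <= n)%N -> is_ideal (J n))
    (hIJ : I `<=` \bigcup_(n in [set n : nat | (1 <= n)%N]) J n) :
  exists n : nat, (1 <= n)%N /\ I `<=` J n.
Proof.
have allfg (K : set R) : is_ideal K -> fg K.
  by case: hR => -[? ?]; [exact: (artinian_fg hlocal) | exact: noetherian_fg].
have ncM : ~ coset_cover [set: R] M.
  move=> /(coset_cover_pow allfg) cM.
  case: hR => [[ncR art]|[noe [_ ncR]]].
    have [N MN0] := artinian_nilpotent hlocal art; apply: ncR.
    have [t tP] := cM N; apply: coset_cover0_countable.
    by exists t => x Tx; have [n /MN0] := tP x Tx; exists n.
  apply: ncR; apply: (coset_cover_card (ideal_idpow M) cM).
  exact: krull.
have [s Is] := allfg _ hI.
have [n||n sJ] := @sub_bigcup_adjoin_seq _ _ hlocal (fun n => J n.+1) s ncM.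
- exact: hJ.
- by rewrite -Is => x /hIJ[[//|m] _ Jx]; exists m.
- by exists n.+1; rewrite Is.
Qed.
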